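(* Let $\mathcal C$ be a semi-$\mathcal Z$-prenormal category such that $\mathcal Z$ is also a reflective subcategory of $\mathcal C$. For each object $X$ let $\epsilon_X\colon \zeta X\to X$ denote a $\mathcal Z$-coreflection of $X$. The bijective correspondence between weakly hereditary $\mathcal Z$-normal closure operators $C$ on $\mathcal C$ (up to isomorphism) and $\mathcal Z$-torsion theories on $\mathcal C$, under which $C$ corresponds to the $\mathcal Z$-torsion theory $$\mathcal T=\{X\in\mathcal C\mid \epsilon_X\text{ is }C\text{-dense}\},\qquad \mathcal F=\{X\in\mathcal C\mid \epsilon_X\text{ is }C\text{-closed}\},$$ specialises to a bijective correspondence between $\mathcal Z$-hereditary $\mathcal Z$-torsion theories on $\mathcal C$ and hereditary $\mathcal Z$-normal closure operators on $\mathcal C$ (up to isomorphism).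
   Context: Let $\mathcal C$ be a category and $\mathcal Z$ a full replete subcategory (the trivial objects). A morphism of $\mathcal C$ is $\mathcal Z$-trivial if it factors through an object of $\mathcal Z$. A $\mathcal Z$-kernel of $f\colon A\to B$ is a pair $(K,k\colon K\to A)$ such that $f\circ k$ is $\mathcal Z$-trivial and every $x\colon X\to A$ with $f\circ x$ $\mathcal Z$-trivial factors uniquely as $x=k\circ x'$. A $\mathcal Z$-cokernel is defined dually. A $\mathcal Z$-normal monomorphism (resp. $\mathcal Z$-normal epimorphism) is a morphism that is a $\mathcal Z$-kernel (resp. $\mathcal Z$-cokernel) of some morphism. A sequence $A\xrightarrow{f}B\xrightarrow{g}C$ is $\mathcal Z$-exact if $(A,f)$ is the $\mathcal Z$-kernel of $g$ and $(C,g)$ is the $\mathcal Z$-cokernel of $f$. A morphism has $\mathcal Z$-trivial $\mathcal Z$-kernel if its $\mathcal Z$-kernel $(K,k)$ exists and $k$ is a $\mathcal Z$-trivial morphism. $\mathcal C$ is semi-$\mathcal Z$-prenormal if $\mathcal Z$ is mono-coreflective in $\mathcal C$ (the inclusion has a right adjoint and the counit components are monomorphisms) and: (1) $\mathcal C$ has pullbacks along $\mathcal Z$-normal monomorphisms; (2) $\mathcal C$ has $\mathcal Z$-cokernels of $\mathcal Z$-kernels; (3) the pullback of a $\mathcal Z$-normal epimorphism along a $\mathcal Z$-normal monomorphism is a $\mathcal Z$-normal epimorphism. A $\mathcal Z$-torsion theory on $\mathcal C$ is a pair $(\mathcal T,\mathcal F)$ of full replete subcategories such that every morphism $A\to B$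 with $A\in\mathcal T$, $B\in\mathcal F$ is $\mathcal Z$-trivial, and for every object $X$ there is a $\mathcal Z$-exact sequence $A\to X\to B$ with $A\in\mathcal T$ and $B\in\mathcal F$. It is $\mathcal Z$-hereditary if for every morphism $X\to Y$ with $\mathcal Z$-trivial $\mathcal Z$-kernel such that $Y\in\mathcal T$, also $X\in\mathcal T$. Closure operators. Let $\mathcal M$ be the class of $\mathcal Z$-normal monomorphisms of $\mathcal C$ and $\mathcal M(X)$ the class of those with codomain $X$ (when $\mathcal Z$ is reflective, identities belong to $\mathcal M$). For monomorphisms $m,n$ with the same codomain, write $m\le n$ if $m=n\circ j$ for some (unique) $j$, and $m\cong n$ if $m\le n$ and $n\le m$. For $f\colon Y\to X$ and $a\in\mathcal M(X)$, $f^{-1}(a)\in\mathcal M(Y)$ denotes the pullback of $a$ along $f$. A closure operator $C$ on $\mathcal M$ is a family of functions $c_X\colon\mathcal M(X)\to\mathcal M(X)$, one for each object $X$, such that for all $a,b\in\mathcal M(X)$ and $f\colon Y\to X$: $a\le c_X(a)$; $a\le b$ implies $c_X(a)\le c_X(b)$; $c_Y(f^{-1}(a))\le f^{-1}(c_X(a))$. An element $a\in\mathcal M(X)$ is $C$-closed if $c_X(a)\cong a$, and $C$-dense if $c_X(a)\cong \mathrm{id}_X$. $C$ is idempotent if $c_X(c_X(a))\cong c_X(a)$ for all $a$. An idempotent closure operator is weakly hereditary if for all $a\colon A\to X$ in $\mathcal M(X)$, with $c_X(a)\colon B\to X$ and $j\colon A\to B$ the unique morphism with $c_X(a)\circ j=a$,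 one has $c_B(j)\cong\mathrm{id}_B$. It is hereditary if $c_Y(f^{-1}(a))\cong f^{-1}(c_X(a))$ for all $a\in\mathcal M(X)$ and all morphisms $f\colon Y\to X$ (hereditary closure operators are weakly hereditary). A $\mathcal Z$-normal closure operator on $\mathcal C$ is an idempotent closure operator on $\mathcal M$ such that $c_Y(f^{-1}(a))\cong f^{-1}(c_X(a))$ for all $a\in\mathcal M(X)$ and all $\mathcal Z$-normal epimorphisms $f\colon Y\to X$. Two closure operators $C,C'$ are isomorphic if $c_X(a)\cong c'_X(a)$ for all $X$ and $a\in\mathcal M(X)$; closure operators are identified up to isomorphism. *)

(* Defs.v *)
Set Implicit Arguments.
Unset Strict Implicit.
Unset Printing Implicit Defensive.

Declare Scope cat_scope.
Delimit Scope cat_scope with cat.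
Local Open Scope cat_scope.

(* Parallel morphisms are compared with Leibniz equality. *)
Record category : Type := Category {
  ob :> Type;
  hom : ob -> ob -> Type;
  idm : forall X, hom X X;
  comp : forall X Y Z, hom Y Z -> hom X Y -> hom X Z;
  comp_idl : forall X Y (f : hom X Y), comp (idm Y) f = f;
  comp_idr : forall X Y (f : hom X Y), comp f (idm X) = f;
  comp_assoc : forall W X Y Z (h : hom Y Z) (g : hom X Y) (f : hom W X),
    comp h (comp g f) = comp (comp h g) f
}.

Arguments hom {c} X Y.
Arguments idm {c} X.
Arguments comp {c X Y Z} g f.

Notation "g ∘ f" := (comp g f) (at level 40, left associativity) : cat_scope.

Definition mono (C : category) (A B : C) (m : hom A B) : Prop :=
  forall (X : C) (u v : hom X A), m ∘ u = m ∘ v -> u = v.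

Definition isomorphic (C : category) (X Y : C) : Prop :=
  exists (f : hom X Y) (g : hom Y X), g ∘ f = idm X /\ f ∘ g = idm Y.

(* A full replete subcategory is given by its class of objects. *)
Definition replete (C : category) (P : C -> Prop) : Prop :=
  forall X Y : C, isomorphic X Y -> P X -> P Y.

Definition is_pullback (C : category) (P Y A X : C)
    (f : hom Y X) (a : hom A X) (p : hom P Y) (q : hom P A) : Prop :=
  f ∘ p = a ∘ q /\
  forall (W : C) (y : hom W Y) (x : hom W A), f ∘ y = a ∘ x ->
    exists! w : hom W P, p ∘ w = y /\ q ∘ w = x.

(* The order on morphisms with a common codomain; it is only used for
   monomorphisms, where the factorisation is unique. *)
Definition sub_le (C : category) (A B X : C) (m : hom A X) (n : hom B X) : Prop :=
  exists j : hom A B, m = n ∘ j.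

Definition sub_eq (C : category) (A B X : C) (m : hom A X) (n : hom B X) : Prop :=
  sub_le m n /\ sub_le n m.

(* The inclusion of Z has a right (left) adjoint iff every object has a
   universal arrow from (to) Z, i.e. a coreflection (reflection). *)
Definition is_coreflection (C : category) (Z : C -> Prop) (W X : C)
    (e : hom W X) : Prop :=
  Z W /\ forall (V : C) (x : hom V X), Z V -> exists! x' : hom V W, e ∘ x' = x.

Definition is_reflection (C : category) (Z : C -> Prop) (X W : C)
    (r : hom X W) : Prop :=
  Z W /\ forall (V : C) (x : hom X V), Z V -> exists! x' : hom W V, x' ∘ r = x.

Definition mono_coreflective (C : category) (Z : C -> Prop) : Prop :=
  forall X : C, exists (W : C) (e : hom W X), is_coreflection Z e /\ mono e.

Definition reflective (C : category) (Z : C -> Prop) : Prop :=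
  forall X : C, exists (W : C) (r : hom X W), is_reflection Z r.

Definition trivial_mor (C : category) (Z : C -> Prop) (A B : C)
    (f : hom A B) : Prop :=
  exists (W : C) (u : hom A W) (v : hom W B), Z W /\ f = v ∘ u.

Definition is_zkernel (C : category) (Z : C -> Prop) (K A B : C)
    (f : hom A B) (k : hom K A) : Prop :=
  trivial_mor Z (f ∘ k) /\
  forall (X : C) (x : hom X A), trivial_mor Z (f ∘ x) ->
    exists! x' : hom X K, k ∘ x' = x.

Definition is_zcokernel (C : category) (Z : C -> Prop) (A B Q : C)
    (f : hom A B) (q : hom B Q) : Prop :=
  trivial_mor Z (q ∘ f) /\
  forall (X : C) (x : hom B X), trivial_mor Z (x ∘ f) ->
    exists! x' : hom Q X, x' ∘ q = x.

Definition normal_mono (C : category) (Z : C -> Prop) (K A : C)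
    (k : hom K A) : Prop :=
  exists (B : C) (f : hom A B), is_zkernel Z f k.

Definition normal_epi (C : category) (Z : C -> Prop) (B Q : C)
    (q : hom B Q) : Prop :=
  exists (A : C) (f : hom A B), is_zcokernel Z f q.

Definition zexact (C : category) (Z : C -> Prop) (A B D : C)
    (f : hom A B) (g : hom B D) : Prop :=
  is_zkernel Z g f /\ is_zcokernel Z f g.

Definition has_trivial_zkernel (C : category) (Z : C -> Prop) (A B : C)
    (f : hom A B) : Prop :=
  exists (K : C) (k : hom K A), is_zkernel Z f k /\ trivial_mor Z k.

Record semi_prenormal (C : category) (Z : C -> Prop) : Prop := SemiPrenormal {
  sp_mono_coreflective : mono_coreflective Z;
  sp_pullbacks : forall (A X Y : C) (f : hom Y X) (a : hom A X),
    normal_mono Z a ->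
    exists (P : C) (p : hom P Y) (q : hom P A), is_pullback f a p q;
  sp_cokernels : forall (K A : C) (k : hom K A), normal_mono Z k ->
    exists (Q : C) (q : hom A Q), is_zcokernel Z k q;
  sp_stable : forall (P Y A X : C)
      (f : hom Y X) (a : hom A X) (p : hom P Y) (q : hom P A),
    normal_epi Z f -> normal_mono Z a -> is_pullback f a p q -> normal_epi Z q
}.

Record class_pair (C : category) : Type := ClassPair {
  tors : C -> Prop;
  tfree : C -> Prop
}.

Definition class_pair_eq (C : category) (P P' : class_pair C) : Prop :=
  forall X : C, (tors P X <-> tors P' X) /\ (tfree P X <-> tfree P' X).

Record torsion_theory (C : category) (Z : C -> Prop) (P : class_pair C) : Prop :=
  TorsionTheory {
    tt_tors_replete : replete (tors P);
    tt_tfree_replete : replete (tfree P);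
    tt_trivial : forall (A B : C) (f : hom A B),
      tors P A -> tfree P B -> trivial_mor Z f;
    tt_exact : forall X : C, exists (A B : C) (f : hom A X) (g : hom X B),
      tors P A /\ tfree P B /\ zexact Z f g
  }.

Definition hereditary_torsion_theory (C : category) (Z : C -> Prop)
    (P : class_pair C) : Prop :=
  torsion_theory Z P /\
  forall (X Y : C) (f : hom X Y),
    has_trivial_zkernel Z f -> tors P Y -> tors P X.

Record nmono (C : category) (Z : C -> Prop) (X : C) : Type := NMono {
  nm_dom : C;
  nm_mor :> hom nm_dom X;
  nm_normal : normal_mono Z nm_mor
}.

Arguments NMono {C Z X nm_dom} nm_mor nm_normal.

(* b represents the inverse image of a along f.  Inverse images are determined
   up to isomorphism of subobjects only, so the axioms below are stated for
   every representative; existence is preimage_exists. *)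
Definition is_preimage (C : category) (Z : C -> Prop) (X Y : C)
    (f : hom Y X) (a : nmono Z X) (b : nmono Z Y) : Prop :=
  exists q : hom (nm_dom b) (nm_dom a), is_pullback f a b q.

Record closure_op (C : category) (Z : C -> Prop) : Type := ClosureOp {
  cl :> forall X : C, nmono Z X -> nmono Z X;
  cl_ext : forall (X : C) (a : nmono Z X), sub_le a (cl a);
  cl_mono : forall (X : C) (a b : nmono Z X), sub_le a b -> sub_le (cl a) (cl b);
  cl_cont : forall (X Y : C) (f : hom Y X) (a : nmono Z X) (b d : nmono Z Y),
    is_preimage f a b -> is_preimage f (cl a) d -> sub_le (cl b) d
}.

Arguments cl {C Z} c {X} a.

Definition closure_op_iso (C : category) (Z : C -> Prop)
    (c c' : closure_op Z) : Prop :=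
  forall (X : C) (a : nmono Z X), sub_eq (cl c a) (cl c' a).

Definition closed (C : category) (Z : C -> Prop) (c : closure_op Z) (X : C)
    (a : nmono Z X) : Prop := sub_eq (cl c a) a.

Definition dense (C : category) (Z : C -> Prop) (c : closure_op Z) (X : C)
    (a : nmono Z X) : Prop := sub_eq (cl c a) (idm X).

Definition idempotent (C : category) (Z : C -> Prop) (c : closure_op Z) : Prop :=
  forall (X : C) (a : nmono Z X), sub_eq (cl c (cl c a)) (cl c a).

Lemma trivial_mor_precomp (C : category) (Z : C -> Prop) (X A B : C)
    (f : hom A B) (x : hom X A) : trivial_mor Z f -> trivial_mor Z (f ∘ x).
Proof.
intros (W & u & v & HW & ->).
exists W, (u ∘ x), v; split; [exact HW|].
symmetry; apply comp_assoc.
Qed.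

Lemma zkernel_mono (C : category) (Z : C -> Prop) (K A B : C)
    (f : hom A B) (k : hom K A) : is_zkernel Z f k -> mono k.
Proof.
intros [Hk Uk] X u v E.
destruct (Uk X (k ∘ u)) as [w [_ Hw]].
- rewrite comp_assoc; apply trivial_mor_precomp; exact Hk.
- rewrite <- (Hw u eq_refl); apply Hw; symmetry; exact E.
Qed.

Lemma normal_mono_mono (C : category) (Z : C -> Prop) (K A : C) (k : hom K A) :
  normal_mono Z k -> mono k.
Proof. intros (B & f & H); exact (zkernel_mono H). Qed.

Lemma normal_mono_factor (C : category) (Z : C -> Prop) (A B X : C)
    (a : hom A X) (b : hom B X) (j : hom A B) :
  normal_mono Z a -> normal_mono Z b -> b ∘ j = a -> normal_mono Z j.
Proof.
intros Ha Hb E; pose proof (normal_mono_mono Ha) as Ma.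
pose proof (normal_mono_mono Hb) as Mb.
destruct Ha as (D & g & [Hg Ug]).
exists D, (g ∘ b); split.
- rewrite <- comp_assoc, E; exact Hg.
- intros W x Hx; rewrite <- comp_assoc in Hx.
  destruct (Ug W (b ∘ x) Hx) as [x' [Ex Ux]].
  exists x'; split.
  + apply Mb; rewrite comp_assoc, E; exact Ex.
  + intros y Ey; apply Ux; rewrite <- E, <- comp_assoc, Ey; reflexivity.
Qed.

Lemma normal_mono_pullback (C : category) (Z : C -> Prop) (P Y A X : C)
    (f : hom Y X) (a : hom A X) (p : hom P Y) (q : hom P A) :
  normal_mono Z a -> is_pullback f a p q -> normal_mono Z p.
Proof.
intros Ha [E U]; pose proof (normal_mono_mono Ha) as Ma.
destruct Ha as (B & g & [Hg Ug]).
exists B, (g ∘ f); split.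
- rewrite <- comp_assoc, E, comp_assoc; apply trivial_mor_precomp; exact Hg.
- intros W y Hy; rewrite <- comp_assoc in Hy.
  destruct (Ug W (f ∘ y) Hy) as [x [Ex _]].
  destruct (U W y x (eq_sym Ex)) as [w [[Ew Ew'] Uw]].
  exists w; split; [exact Ew|].
  intros w' Ew2; apply Uw; split; [exact Ew2|].
  apply Ma; rewrite Ex, comp_assoc, <- E, <- comp_assoc, Ew2; reflexivity.
Qed.

Lemma preimage_exists (C : category) (Z : C -> Prop) (HC : semi_prenormal Z)
    (X Y : C) (f : hom Y X) (a : nmono Z X) :
  exists b : nmono Z Y, is_preimage f a b.
Proof.
destruct (sp_pullbacks HC f (nm_normal a)) as (P & p & q & H).
exists (NMono p (normal_mono_pullback (nm_normal a) H)), q; exact H.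
Qed.

Lemma coreflection_mono (C : category) (Z : C -> Prop)
    (HZ : mono_coreflective Z) (W X : C) (e : hom W X) :
  is_coreflection Z e -> mono e.
Proof.
intros [HW Ue] V u v E.
destruct (HZ X) as (W' & e' & [[HW' Ue'] Me']).
destruct (Ue' W e HW) as [s [Es _]].
destruct (Ue W' e' HW') as [t [Et _]].
assert (Hts : t ∘ s = idm W).
{ destruct (Ue W e HW) as [w [_ Uw]].
  rewrite <- (Uw (t ∘ s)), <- (Uw (idm W)); try reflexivity.
  - apply comp_idr.
  - rewrite comp_assoc, Et; exact Es. }
assert (Esuv : s ∘ u = s ∘ v).
{ apply Me'; rewrite !comp_assoc, Es; exact E. }
rewrite <- (comp_idl u), <- (comp_idl v), <- Hts, <- !comp_assoc, Esuv.
reflexivity.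
Qed.

(* A coreflection of X is a Z-kernel of the identity of X. *)
Lemma coreflection_normal (C : category) (Z : C -> Prop)
    (HZ : mono_coreflective Z) (W X : C) (e : hom W X) :
  is_coreflection Z e -> normal_mono Z e.
Proof.
intros He; pose proof (coreflection_mono HZ He) as Me.
destruct He as [HW Ue].
exists X, (idm X); split.
- exists W, (idm W), e; split; [exact HW|].
  rewrite comp_idl, comp_idr; reflexivity.
- intros V x (V' & u & v & HV' & E); rewrite comp_idl in E.
  destruct (Ue V' v HV') as [v' [Ev _]].
  exists (v' ∘ u); split.
  + rewrite comp_assoc, Ev; symmetry; exact E.
  + intros y Ey; apply Me; rewrite Ey, comp_assoc, Ev; exact (eq_sym E).
Qed.

Definition counit (C : category) (Z : C -> Prop) (HZ : mono_coreflective Z)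
    (zeta : C -> C) (eps : forall X : C, hom (zeta X) X)
    (Heps : forall X : C, is_coreflection Z (eps X)) (X : C) : nmono Z X :=
  NMono (eps X) (coreflection_normal HZ (Heps X)).

Definition weakly_hereditary (C : category) (Z : C -> Prop)
    (c : closure_op Z) : Prop :=
  idempotent c /\
  forall (X : C) (a : nmono Z X) (j : hom (nm_dom a) (nm_dom (cl c a)))
      (E : cl c a ∘ j = a),
    dense c (NMono j (normal_mono_factor (nm_normal a) (nm_normal (cl c a)) E)).

Definition hereditary (C : category) (Z : C -> Prop) (c : closure_op Z) : Prop :=
  idempotent c /\
  forall (X Y : C) (f : hom Y X) (a : nmono Z X) (b d : nmono Z Y),
    is_preimage f a b -> is_preimage f (cl c a) d -> sub_eq (cl c b) d.

Definition normal_closure_op (C : category) (Z : C -> Prop)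
    (c : closure_op Z) : Prop :=
  idempotent c /\
  forall (X Y : C) (f : hom Y X) (a : nmono Z X) (b d : nmono Z Y),
    normal_epi Z f ->
    is_preimage f a b -> is_preimage f (cl c a) d -> sub_eq (cl c b) d.

Definition closure_pair (C : category) (Z : C -> Prop)
    (eps : forall X : C, nmono Z X) (c : closure_op Z) : class_pair C :=
  ClassPair (fun X => dense c (eps X)) (fun X => closed c (eps X)).

(* phi induces a bijection from the elements of A satisfying P, taken up to eqA,
   to the elements of B satisfying Q, taken up to eqB. *)
Definition induces_bijection (A B : Type)
    (P : A -> Prop) (eqA : A -> A -> Prop)
    (Q : B -> Prop) (eqB : B -> B -> Prop) (phi : A -> B) : Prop :=
  (forall a, P a -> Q (phi a)) /\
  (forall a a', P a -> P a' -> (eqA a a' <-> eqB (phi a) (phi a'))) /\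
  (forall b, Q b -> exists a, P a /\ eqB (phi a) b).

(* Main.v *)
Require Import Defs.
From Stdlib Require Import IndefiniteDescription.

(** Everything is read off the generalized elements of a subobject [b] of [X]:
    the morphisms [x : W -> X] that factor through [b], written [sub_le x b].

    From a closure operator to a torsion theory.  Write [e X] for the
    coreflection of [X].  By continuity, every [f : Y -> X] maps [c (e Y)] into
    [c (e X)] ([closure_coreflection_natural]), which at once makes morphisms
    from torsion to torsion-free objects trivial.  The exact sequence of [X] is
    [c (e X)] followed by its cokernel [q : X -> Q].  Its left end is torsion
    by weak heredity.  Its right end is torsion-free because the inverse image
    of [c (e Q)] along the normal epimorphism [q] is [c (c (e X))], that is
    [c (e X)], which [q] kills; triviality can be tested after pulling back
    along a normal epimorphism ([trivial_on_normal_mono]), so [c (e Q)] is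
    trivial.

    From a torsion theory to a closure operator.  The closure of [a] consists of
    the elements that become trivial under every morphism [h] to a torsion-free
    object that trivializes [a].  It exists as a normal monomorphism: with [q]
    the cokernel of [a] and [g : Q -> F] the torsion-free quotient of its
    codomain, [g ∘ q] is universal among these [h], and the closure is its
    kernel.  The axioms of a closure operator and idempotence are formal in this
    description; weak heredity and normality use the stability of normal
    epimorphisms.

    The two passages are mutually inverse.  A normal closure operator is
    determined by its values on coreflections, since every normal monomorphism
    is the inverse image of a coreflection along its cokernel; and when it is
    weakly hereditary, [c (e X)] is the largest torsion subobject of [X], so
    the torsion class determines it ([closure_le_of_torsion]).

    Heredity.  If [c] is hereditary and [f : X -> Y] has trivial kernel, the
    closure of [e X] is the inverse image of the closure of [e Y], so [X] is
    torsion when [Y] is.  Conversely, let [b] be the inverse image of [a] along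
    [f : Y -> X].  The morphism [u : Coker b -> Coker a] induced by [f] has
    trivial kernel, hence so has its restriction to the inverse image [S] of the
    torsion part of [Coker a].  Thus [S] is torsion, and as the cokernel of [b]
    maps [f^-1 (c a)] into [S], the former lies in [c b]
    ([torsion_closure_hereditary]). *)

Set Implicit Arguments.
Unset Strict Implicit.
Unset Printing Implicit Defensive.

Local Open Scope cat_scope.

(** * Trivial morphisms and generalized elements *)

Lemma trivial_mor_postcomp (C : category) (Z : C -> Prop) (A B D : C)
    (g : hom B D) (f : hom A B) : trivial_mor Z f -> trivial_mor Z (g ∘ f).
Proof.
intros (W & u & v & HW & ->).
exists W, u, (g ∘ v); split; [exact HW | apply comp_assoc].
Qed.

Lemma trivial_mor_dom (C : category) (Z : C -> Prop) (W B : C) (f : hom W B) :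
  Z W -> trivial_mor Z f.
Proof.
intros HW; exists W, (idm W), f; split; [exact HW | symmetry; apply comp_idr].
Qed.

Lemma trivial_mor_cod (C : category) (Z : C -> Prop) (A W : C) (f : hom A W) :
  Z W -> trivial_mor Z f.
Proof.
intros HW; exists W, f, (idm W); split; [exact HW | symmetry; apply comp_idl].
Qed.

Lemma sub_le_refl (C : category) (A X : C) (m : hom A X) : sub_le m m.
Proof. exists (idm A); symmetry; apply comp_idr. Qed.

Lemma sub_le_comp (C : category) (A W X : C) (m : hom A X) (x : hom W A) :
  sub_le (m ∘ x) m.
Proof. exists x; reflexivity. Qed.

Lemma sub_le_trans (C : category) (A B D X : C)
    (m : hom A X) (n : hom B X) (p : hom D X) :
  sub_le m n -> sub_le n p -> sub_le m p.
Proof.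
intros [i ->] [j ->]; exists (j ∘ i); symmetry; apply comp_assoc.
Qed.

Lemma sub_le_id (C : category) (A X : C) (m : hom A X) : sub_le m (idm X).
Proof. exists m; symmetry; apply comp_idl. Qed.

Lemma sub_le_mono_comp (C : category) (A B D X : C)
    (m : hom B X) (u : hom A B) (v : hom D B) :
  mono m -> sub_le (m ∘ u) (m ∘ v) -> sub_le u v.
Proof.
intros Hm [w E]; exists w; apply Hm; rewrite comp_assoc; exact E.
Qed.

Lemma coreflection_le (C : category) (Z : C -> Prop) (E X W : C)
    (e : hom E X) (x : hom W X) :
  is_coreflection Z e -> (sub_le x e <-> trivial_mor Z x).
Proof.
intros [HE He]; split.
- intros [x' ->]; apply trivial_mor_precomp, trivial_mor_dom; exact HE.
- intros (V & u & v & HV & ->).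
  destruct (He V v HV) as [v' [<- _]].
  rewrite <- comp_assoc; apply sub_le_comp.
Qed.

Lemma zkernel_le (C : category) (Z : C -> Prop) (K A B W : C)
    (f : hom A B) (k : hom K A) (x : hom W A) :
  is_zkernel Z f k -> (sub_le x k <-> trivial_mor Z (f ∘ x)).
Proof.
intros [Hk Uk]; split.
- intros [x' ->]; rewrite comp_assoc; apply trivial_mor_precomp; exact Hk.
- intros Hx; destruct (Uk W x Hx) as [x' [E _]].
  exists x'; symmetry; exact E.
Qed.

Lemma zkernel_intro (C : category) (Z : C -> Prop) (K A B : C)
    (f : hom A B) (k : hom K A) :
  mono k ->
  (forall (W : C) (x : hom W A), sub_le x k <-> trivial_mor Z (f ∘ x)) ->
  is_zkernel Z f k.
Proof.
intros Mk Hk; split.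
- apply Hk, sub_le_refl.
- intros W x Hx; destruct (proj2 (Hk W x) Hx) as [x' E].
  exists x'; split; [symmetry; exact E|].
  intros y Ey; apply Mk; rewrite Ey; symmetry; exact E.
Qed.

Lemma pullback_le (C : category) (P Y A X W : C)
    (f : hom Y X) (a : hom A X) (p : hom P Y) (q : hom P A) (y : hom W Y) :
  is_pullback f a p q -> (sub_le y p <-> sub_le (f ∘ y) a).
Proof.
intros [E U]; split.
- intros [w ->]; rewrite comp_assoc, E, <- comp_assoc; apply sub_le_comp.
- intros [x Ex]; destruct (U W y x Ex) as [w [[Ew _] _]].
  exists w; symmetry; exact Ew.
Qed.

Lemma preimage_le (C : category) (Z : C -> Prop) (X Y W : C)
    (f : hom Y X) (a : nmono Z X) (b : nmono Z Y) (y : hom W Y) :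
  is_preimage f a b -> (sub_le y b <-> sub_le (f ∘ y) a).
Proof. intros [q H]; exact (pullback_le y H). Qed.

Lemma preimage_intro (C : category) (Z : C -> Prop) (X Y : C)
    (f : hom Y X) (a : nmono Z X) (b : nmono Z Y) :
  (forall (W : C) (y : hom W Y), sub_le y b <-> sub_le (f ∘ y) a) ->
  is_preimage f a b.
Proof.
intros H; pose proof (normal_mono_mono (nm_normal a)) as Ma.
pose proof (normal_mono_mono (nm_normal b)) as Mb.
destruct (proj1 (H _ b) (sub_le_refl b)) as [q Eq].
exists q; split; [exact Eq|].
intros W y x E.
assert (Hy : sub_le (f ∘ y) a) by (exists x; exact E).
destruct (proj2 (H W y) Hy) as [w Ew].
exists w; split; [split|].
- symmetry; exact Ew.
- apply Ma; rewrite comp_assoc, <- Eq, <- comp_assoc, <- Ew; exact E.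
- intros w' [Ew' _]; apply Mb; rewrite Ew'; symmetry; exact Ew.
Qed.

(** * Normal monomorphisms and normal epimorphisms *)

Lemma normal_mono_trivial_le (C : category) (Z : C -> Prop) (K A W : C)
    (k : hom K A) (x : hom W A) :
  normal_mono Z k -> trivial_mor Z x -> sub_le x k.
Proof.
intros (B & g & Hg) Hx.
apply (zkernel_le x Hg), trivial_mor_postcomp; exact Hx.
Qed.

(** The object of [Z] through which [k ∘ u] factors maps into the codomain of
    [k], hence through [k] itself. *)
Lemma normal_mono_reflects_trivial (C : category) (Z : C -> Prop) (W K A : C)
    (k : hom K A) (u : hom W K) :
  normal_mono Z k -> trivial_mor Z (k ∘ u) -> trivial_mor Z u.
Proof.
intros Hk (V & w & v & HV & E).
destruct (normal_mono_trivial_le Hk (trivial_mor_dom v HV)) as [v' ->].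
exists V, w, v'; split; [exact HV|].
apply (normal_mono_mono Hk); rewrite E; symmetry; apply comp_assoc.
Qed.

Lemma zkernel_exists (C : category) (Z : C -> Prop) (HC : semi_prenormal Z)
    (A B : C) (f : hom A B) :
  exists (K : C) (k : hom K A), is_zkernel Z f k.
Proof.
destruct (sp_mono_coreflective HC B) as (E & e & He & _).
pose proof (coreflection_normal (sp_mono_coreflective HC) He) as Ne.
destruct (sp_pullbacks HC f Ne) as (K & k & q & Hk).
exists K, k; apply zkernel_intro.
- exact (normal_mono_mono (normal_mono_pullback Ne Hk)).
- intros W x.
  exact (iff_trans (pullback_le x Hk) (coreflection_le (f ∘ x) He)).
Qed.

Lemma zcokernel_epi (C : category) (Z : C -> Prop) (A B Q X : C)
    (f : hom A B) (q : hom B Q) (u v : hom Q X) :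
  is_zcokernel Z f q -> u ∘ q = v ∘ q -> u = v.
Proof.
intros [Hq Uq] E; destruct (Uq X (v ∘ q)) as [w [_ Hw]].
- rewrite <- comp_assoc; apply trivial_mor_postcomp; exact Hq.
- rewrite <- (Hw v eq_refl); symmetry; apply Hw; exact E.
Qed.

Lemma zcokernel_factor (C : category) (Z : C -> Prop) (A B Q X : C)
    (f : hom A B) (q : hom B Q) (h : hom B X) :
  is_zcokernel Z f q -> trivial_mor Z (h ∘ f) -> exists h' : hom Q X, h = h' ∘ q.
Proof.
intros [_ Uq] Hh; destruct (Uq X h Hh) as [h' [E _]].
exists h'; symmetry; exact E.
Qed.

Lemma zcokernel_normal_epi (C : category) (Z : C -> Prop) (A B Q : C)
    (f : hom A B) (q : hom B Q) : is_zcokernel Z f q -> normal_epi Z q.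
Proof. intros H; exists A, f; exact H. Qed.

Lemma normal_mono_zkernel_of_zcokernel (C : category) (Z : C -> Prop)
    (A X Q : C) (a : hom A X) (q : hom X Q) :
  normal_mono Z a -> is_zcokernel Z a q -> is_zkernel Z q a.
Proof.
intros Na Hq; apply zkernel_intro; [exact (normal_mono_mono Na)|].
destruct Na as (B & f & Hf).
intros W x; split.
- intros [x' ->]; rewrite comp_assoc.
  apply trivial_mor_precomp; exact (proj1 Hq).
- intros Hx; apply (zkernel_le x Hf).
  destruct (zcokernel_factor Hq (proj1 Hf)) as [f' ->].
  rewrite <- comp_assoc; apply trivial_mor_postcomp; exact Hx.
Qed.

Lemma normal_epi_zcokernel_of_zkernel (C : category) (Z : C -> Prop)
    (K X Q : C) (k : hom K X) (q : hom X Q) :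
  normal_epi Z q -> is_zkernel Z q k -> is_zcokernel Z k q.
Proof.
intros (A & f & Hf) Hk; split; [exact (proj1 Hk)|].
intros V h Hh; apply (proj2 Hf).
destruct (proj2 (zkernel_le f Hk) (proj1 Hf)) as [w ->].
rewrite comp_assoc; apply trivial_mor_precomp; exact Hh.
Qed.

Lemma normal_epi_reflects_trivial (C : category) (Z : C -> Prop) (B Q V : C)
    (q : hom B Q) (u : hom Q V) :
  normal_epi Z q -> trivial_mor Z (u ∘ q) -> trivial_mor Z u.
Proof.
intros (A & f & Hf) (W & w & v & HW & E).
destruct (zcokernel_factor Hf (trivial_mor_cod (w ∘ f) HW)) as [w' ->].
exists W, w', v; split; [exact HW|].
apply (zcokernel_epi Hf); rewrite E; apply comp_assoc.
Qed.

(** The projection of the pullback onto the domain of [n] is a normal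
    epimorphism, and normal epimorphisms reflect triviality. *)
Lemma trivial_on_normal_mono (C : category) (Z : C -> Prop)
    (HC : semi_prenormal Z) (Y X V : C) (q : hom Y X)
    (n : nmono Z X) (p : nmono Z Y) (h : hom X V) :
  normal_epi Z q -> is_preimage q n p ->
  trivial_mor Z (h ∘ q ∘ p) -> trivial_mor Z (h ∘ n).
Proof.
intros Hq [q' Hp] Ht.
apply (normal_epi_reflects_trivial (sp_stable HC Hq (nm_normal n) Hp)).
rewrite <- comp_assoc, <- (proj1 Hp), comp_assoc; exact Ht.
Qed.

(** * Closure operators on generalized elements *)

Lemma dense_iff (C : category) (Z : C -> Prop) (c : closure_op Z) (X : C)
    (a : nmono Z X) :
  dense c a <-> forall (W : C) (x : hom W X), sub_le x (cl c a).
Proof.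
split.
- intros [_ H] W x; exact (sub_le_trans (sub_le_id x) H).
- intros H; split; [apply sub_le_id | apply H].
Qed.

Lemma closed_iff (C : category) (Z : C -> Prop) (c : closure_op Z) (X : C)
    (a : nmono Z X) :
  closed c a <-> sub_le (cl c a) a.
Proof.
split; [intros [H _]; exact H|].
intros H; split; [exact H | apply cl_ext].
Qed.

Lemma closure_continuous (C : category) (Z : C -> Prop)
    (HC : semi_prenormal Z) (c : closure_op Z) (X Y W : C) (f : hom Y X)
    (a : nmono Z X) (b : nmono Z Y) (y : hom W Y) :
  is_preimage f a b -> sub_le y (cl c b) -> sub_le (f ∘ y) (cl c a).
Proof.
intros Hb Hy; destruct (preimage_exists HC f (cl c a)) as [d Hd].
apply (preimage_le y Hd).
exact (sub_le_trans Hy (cl_cont Hb Hd)).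
Qed.

Lemma closure_normal_epi (C : category) (Z : C -> Prop)
    (HC : semi_prenormal Z) (c : closure_op Z) (X Y W : C) (f : hom Y X)
    (a : nmono Z X) (b : nmono Z Y) (y : hom W Y) :
  normal_closure_op c -> normal_epi Z f -> is_preimage f a b ->
  (sub_le y (cl c b) <-> sub_le (f ∘ y) (cl c a)).
Proof.
intros [_ Hc] Hf Hb; split; [exact (closure_continuous HC Hb)|].
intros Hy; destruct (preimage_exists HC f (cl c a)) as [d Hd].
apply (preimage_le y Hd) in Hy.
exact (sub_le_trans Hy (proj2 (Hc _ _ _ _ _ _ Hf Hb Hd))).
Qed.

Lemma closure_coreflection_natural (C : category) (Z : C -> Prop)
    (HC : semi_prenormal Z) (e : forall X : C, nmono Z X)
    (He : forall X : C, is_coreflection Z (e X)) (c : closure_op Z)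
    (X Y W : C) (f : hom Y X) (y : hom W Y) :
  sub_le y (cl c (e Y)) -> sub_le (f ∘ y) (cl c (e X)).
Proof.
intros Hy; destruct (preimage_exists HC f (e X)) as [b Hb].
apply (closure_continuous HC Hb).
apply (sub_le_trans Hy), cl_mono, (normal_mono_trivial_le (nm_normal b)).
apply (coreflection_le _ (He Y)), sub_le_refl.
Qed.

(** A normal monomorphism is the kernel of its cokernel, and a kernel is the
    inverse image of a coreflection. *)
Lemma cokernel_preimage (C : category) (Z : C -> Prop)
    (e : forall X : C, nmono Z X) (He : forall X : C, is_coreflection Z (e X))
    (X Q : C) (a : nmono Z X) (q : hom X Q) :
  is_zcokernel Z a q -> is_preimage q (e Q) a.
Proof.
intros Hq; apply preimage_intro; intros W y.
pose proof (normal_mono_zkernel_of_zcokernel (nm_normal a) Hq) as Ha.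
exact (iff_trans (zkernel_le y Ha) (iff_sym (coreflection_le (q ∘ y) (He Q)))).
Qed.

(** The pullback of [a] along its closure is the comparison morphism from [a]
    to its closure, and the pullback of the closure along itself is an
    identity. *)
Lemma hereditary_weakly_hereditary (C : category) (Z : C -> Prop)
    (HC : semi_prenormal Z) (c : closure_op Z) :
  hereditary c -> weakly_hereditary c.
Proof.
intros [Hi Hc]; split; [exact Hi|].
intros X a j E; apply dense_iff; intros W x.
destruct (preimage_exists HC (cl c a) (cl c a)) as [d Hd].
refine (sub_le_trans _ (proj2 (Hc _ _ (cl c a) a _ d _ Hd))).
- apply (preimage_le x Hd), sub_le_comp.
- apply preimage_intro; intros V y; cbn; split.
  + intros [v ->]; rewrite comp_assoc, E; apply sub_le_comp.
  + intros Hy; apply (sub_le_mono_comp (normal_mono_mono (nm_normal (cl c a)))).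
    rewrite E; exact Hy.
Qed.

(** * The torsion theory of a closure operator *)

Lemma closure_coreflection_torsion (C : category) (Z : C -> Prop)
    (e : forall X : C, nmono Z X) (He : forall X : C, is_coreflection Z (e X))
    (c : closure_op Z) (X : C) :
  weakly_hereditary c -> dense c (e (nm_dom (cl c (e X)))).
Proof.
intros [_ Hc]; destruct (cl_ext c (e X)) as [j E].
pose proof (Hc X (e X) j (eq_sym E)) as Hj; rewrite dense_iff in Hj.
apply dense_iff; intros W x; apply (sub_le_trans (Hj W x)), cl_mono.
apply (coreflection_le _ (He _)), trivial_mor_dom; exact (proj1 (He X)).
Qed.

Lemma closure_torsion_theory (C : category) (Z : C -> Prop)
    (HC : semi_prenormal Z) (e : forall X : C, nmono Z X)
    (He : forall X : C, is_coreflection Z (e X)) (c : closure_op Z) :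
  weakly_hereditary c -> normal_closure_op c ->
  torsion_theory Z (closure_pair e c).
Proof.
intros Hw Hn; constructor; cbn.
- intros X Y (f & g & _ & E); rewrite !dense_iff; intros H W y.
  rewrite <- (comp_idl y), <- E, <- comp_assoc.
  apply (closure_coreflection_natural HC He), H.
- intros X Y (f & g & _ & E); rewrite !closed_iff; intros H.
  apply (coreflection_le _ (He Y)).
  rewrite <- (comp_idl (cl c (e Y))), <- E, <- comp_assoc.
  apply trivial_mor_postcomp, (coreflection_le _ (He X)).
  refine (sub_le_trans _ H).
  apply (closure_coreflection_natural HC He), sub_le_refl.
- intros A B f HA HB; rewrite dense_iff in HA; rewrite closed_iff in HB.
  apply (coreflection_le _ (He B)); rewrite <- (comp_idr f).
  refine (sub_le_trans _ HB).
  apply (closure_coreflection_natural HC He), HA.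
- intros X; set (k := cl c (e X)).
  destruct (sp_cokernels HC (nm_normal k)) as (Q & q & Hq).
  exists (nm_dom k), Q, k, q; split; [|split; [|split]].
  + exact (closure_coreflection_torsion He X Hw).
  + apply closed_iff, (coreflection_le _ (He Q)).
    rewrite <- (comp_idl (cl c (e Q))).
    destruct (preimage_exists HC q (cl c (e Q))) as [p Hp].
    apply (trivial_on_normal_mono HC (zcokernel_normal_epi Hq) Hp).
    rewrite comp_idl.
    (* [p] is the closure of [k], hence contained in [k], which [q] kills. *)
    apply (zkernel_le p (normal_mono_zkernel_of_zcokernel (nm_normal k) Hq)).
    refine (sub_le_trans _ (proj1 (proj1 Hw X (e X)))).
    apply (closure_normal_epi HC p Hn (zcokernel_normal_epi Hq)
             (cokernel_preimage He Hq)).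
    apply (preimage_le p Hp), sub_le_refl.
  + exact (normal_mono_zkernel_of_zcokernel (nm_normal k) Hq).
  + exact Hq.
Qed.

(** On a coreflection, [c (e Q)] is torsion for [c], hence for [c'], so its
    inclusion lands in [c' (e Q)]; the general case is pulled back along a
    cokernel. *)
Lemma closure_le_of_torsion (C : category) (Z : C -> Prop)
    (HC : semi_prenormal Z) (e : forall X : C, nmono Z X)
    (He : forall X : C, is_coreflection Z (e X)) (c c' : closure_op Z) :
  weakly_hereditary c -> normal_closure_op c' ->
  (forall X : C, dense c (e X) -> dense c' (e X)) ->
  forall (X : C) (a : nmono Z X), sub_le (cl c a) (cl c' a).
Proof.
intros Hw Hn' H X a.
destruct (sp_cokernels HC (nm_normal a)) as (Q & q & Hq).
pose proof (cokernel_preimage He Hq) as Ha.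
apply (closure_normal_epi HC _ Hn' (zcokernel_normal_epi Hq) Ha).
apply sub_le_trans with (n := nm_mor (cl c (e Q))).
- apply (closure_continuous HC Ha), sub_le_refl.
- rewrite <- (comp_idr (cl c (e Q))).
  apply (closure_coreflection_natural HC He).
  apply (proj1 (dense_iff c' (e _))), H.
  exact (closure_coreflection_torsion He Q Hw).
Qed.

Lemma closure_op_iso_iff (C : category) (Z : C -> Prop)
    (HC : semi_prenormal Z) (e : forall X : C, nmono Z X)
    (He : forall X : C, is_coreflection Z (e X)) (c c' : closure_op Z) :
  weakly_hereditary c -> normal_closure_op c ->
  weakly_hereditary c' -> normal_closure_op c' ->
  (closure_op_iso c c' <->
   class_pair_eq (closure_pair e c) (closure_pair e c')).
Proof.
intros Hw Hn Hw' Hn'; split.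
- intros Hcc X; cbn; rewrite !dense_iff, !closed_iff.
  destruct (Hcc X (e X)) as [H1 H2]; split; split.
  + intros H W x; exact (sub_le_trans (H W x) H1).
  + intros H W x; exact (sub_le_trans (H W x) H2).
  + intros H; exact (sub_le_trans H2 H).
  + intros H; exact (sub_le_trans H1 H).
- intros H X a; split.
  + apply (closure_le_of_torsion HC He Hw Hn'); intros Y; apply (H Y).
  + apply (closure_le_of_torsion HC He Hw' Hn); intros Y; apply (H Y).
Qed.

Lemma closure_hereditary_torsion_theory (C : category) (Z : C -> Prop)
    (HC : semi_prenormal Z) (e : forall X : C, nmono Z X)
    (He : forall X : C, is_coreflection Z (e X)) (c : closure_op Z) :
  hereditary c -> normal_closure_op c ->
  hereditary_torsion_theory Z (closure_pair e c).
Proof.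
intros Hc Hn; split.
{ apply (closure_torsion_theory HC He); [|exact Hn].
  exact (hereditary_weakly_hereditary HC Hc). }
intros X Y f (K & k & Hk & Tk); cbn; rewrite !dense_iff; intros HY W x.
set (b := NMono k (ex_intro _ Y (ex_intro _ f Hk)) : nmono Z X).
assert (Hb : is_preimage f (e Y) b).
{ apply preimage_intro; intros V y.
  exact (iff_trans (zkernel_le y Hk)
           (iff_sym (coreflection_le (f ∘ y) (He Y)))). }
destruct (preimage_exists HC f (cl c (e Y))) as [d Hd].
apply sub_le_trans with (n := nm_mor d).
- apply (preimage_le x Hd), HY.
- apply (sub_le_trans (proj2 (proj2 Hc _ _ _ _ _ _ Hb Hd))), cl_mono.
  apply (coreflection_le _ (He X)); exact Tk.
Qed.

(** * The closure operator of a torsion theory *)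

Definition is_torsion_closure (C : category) (Z : C -> Prop)
    (P : class_pair C) (X : C) (a b : nmono Z X) : Prop :=
  forall (W : C) (x : hom W X),
    sub_le x b <->
    forall (F : C) (h : hom X F),
      tfree P F -> trivial_mor Z (h ∘ a) -> trivial_mor Z (h ∘ x).

(** The composite of the cokernel of [a] with the torsion-free quotient is
    universal among the morphisms to torsion-free objects that trivialize [a];
    its kernel is the closure. *)
Lemma torsion_closure_exists (C : category) (Z : C -> Prop)
    (HC : semi_prenormal Z) (P : class_pair C) (HP : torsion_theory Z P)
    (X : C) (a : nmono Z X) :
  exists b : nmono Z X, is_torsion_closure P a b.
Proof.
destruct (sp_cokernels HC (nm_normal a)) as (Q & q & Hq).
destruct (tt_exact HP Q) as (T & F & t & g & HT & HF & _ & Hg).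
destruct (zkernel_exists HC (g ∘ q)) as (B & b & Hb).
exists (NMono b (ex_intro _ F (ex_intro _ (g ∘ q) Hb))).
intros W x; cbn; rewrite (zkernel_le x Hb); split.
- intros Hx G h HG Ha.
  destruct (zcokernel_factor Hq Ha) as [h' ->].
  destruct (zcokernel_factor Hg (tt_trivial HP (h' ∘ t) HT HG)) as [h'' ->].
  rewrite <- (comp_assoc h''), <- comp_assoc.
  apply trivial_mor_postcomp; exact Hx.
- intros H; apply H; [exact HF|].
  rewrite <- comp_assoc; apply trivial_mor_postcomp; exact (proj1 Hq).
Qed.

Definition is_torsion_closure_op (C : category) (Z : C -> Prop)
    (P : class_pair C) (c : closure_op Z) : Prop :=
  forall (X : C) (a : nmono Z X), is_torsion_closure P a (cl c a).

Lemma torsion_closure_op_exists (C : category) (Z : C -> Prop)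
    (HC : semi_prenormal Z) (P : class_pair C) (HP : torsion_theory Z P) :
  exists c : closure_op Z, is_torsion_closure_op P c.
Proof.
pose (s := fun (X : C) (a : nmono Z X) =>
  constructive_indefinite_description _ (torsion_closure_exists HC HP a)).
pose (k := fun (X : C) (a : nmono Z X) => proj1_sig (s X a)).
assert (Hk : forall X (a : nmono Z X), is_torsion_closure P a (k X a))
  by (intros X a; exact (proj2_sig (s X a))).
clearbody k; clear s.
unshelve eexists (ClosureOp (cl := k) _ _ _); [| | |exact Hk].
- intros X a; apply Hk; intros F h _ Ha; exact Ha.
- intros X a b [j E]; apply Hk; intros F h HF Hb.
  apply (proj1 (Hk X a _ (k X a)) (sub_le_refl _)); [exact HF|].
  rewrite E, comp_assoc; apply trivial_mor_precomp; exact Hb.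
- intros X Y f a b d Hb Hd; apply (preimage_le _ Hd), Hk; intros F h HF Ha.
  rewrite comp_assoc.
  apply (proj1 (Hk Y b _ (k Y b)) (sub_le_refl _)); [exact HF|].
  destruct (proj1 (preimage_le b Hb) (sub_le_refl b)) as [q E].
  rewrite <- comp_assoc, E, comp_assoc; apply trivial_mor_precomp; exact Ha.
Qed.

Lemma torsion_closure_idempotent (C : category) (Z : C -> Prop)
    (P : class_pair C) (c : closure_op Z) :
  is_torsion_closure_op P c -> idempotent c.
Proof.
intros Hc X a; split; [|apply cl_ext].
apply Hc; intros F h HF Ha.
apply (proj1 (Hc X (cl c a) _ _) (sub_le_refl _)); [exact HF|].
apply (proj1 (Hc X a _ _) (sub_le_refl _)); [exact HF | exact Ha].
Qed.

(** Let [q : X -> Q] be the cokernel of [a] and [t : T -> Q] the torsion part.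
    The closure of [a] is the pullback of [t] along [q], so its projection to
    [T] is a normal epimorphism.  The kernel of that projection is the comparison
    [j] from [a] to its closure, so every morphism to a torsion-free object that
    trivializes [j] factors through [T], hence is trivial. *)
Lemma torsion_closure_weakly_hereditary (C : category) (Z : C -> Prop)
    (HC : semi_prenormal Z) (P : class_pair C) (HP : torsion_theory Z P)
    (c : closure_op Z) :
  is_torsion_closure_op P c -> weakly_hereditary c.
Proof.
intros Hc; split; [exact (torsion_closure_idempotent Hc)|].
intros X a j E; apply dense_iff; intros W x; apply Hc; cbn; intros G h HG Hj.
apply trivial_mor_precomp.
destruct (sp_cokernels HC (nm_normal a)) as (Q & q & Hq).
destruct (tt_exact HP Q) as (T & F & t & g & HT & HF & Ht & Hg).
assert (Nt : normal_mono Z t) by (exists F, g; exact Ht).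
assert (HB : is_preimage q (NMono t Nt) (cl c a)).
{ apply preimage_intro; intros V y; cbn.
  rewrite (zkernel_le (q ∘ y) Ht); split.
  - intros Hy; rewrite comp_assoc.
    apply (proj1 (Hc X a V y) Hy); [exact HF|].
    rewrite <- comp_assoc; apply trivial_mor_postcomp; exact (proj1 Hq).
  - intros Hy; apply Hc; intros F' h' HF' Ha'.
    destruct (zcokernel_factor Hq Ha') as [h1 ->].
    destruct (zcokernel_factor Hg (tt_trivial HP (h1 ∘ t) HT HF')) as [h2 ->].
    rewrite <- comp_assoc, <- comp_assoc.
    apply trivial_mor_postcomp; exact Hy. }
destruct HB as [p Hp]; cbn in p, Hp.
pose proof (normal_mono_zkernel_of_zcokernel (nm_normal a) Hq) as Ha.
pose proof (normal_mono_mono (nm_normal (cl c a))) as Mc.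
assert (Kj : is_zkernel Z p j).
{ apply zkernel_intro.
  - apply (@normal_mono_mono C Z).
    exact (normal_mono_factor (nm_normal a) (nm_normal (cl c a)) E).
  - intros V y; split.
    + intros [v ->]; apply (normal_mono_reflects_trivial Nt).
      rewrite !comp_assoc, <- (proj1 Hp), <- (comp_assoc q), E.
      apply trivial_mor_precomp; exact (proj1 Hq).
    + intros Hy; apply (sub_le_mono_comp Mc); rewrite E.
      apply (zkernel_le _ Ha); rewrite comp_assoc, (proj1 Hp), <- comp_assoc.
      apply trivial_mor_postcomp; exact Hy. }
pose proof (sp_stable HC (zcokernel_normal_epi Hq) Nt Hp) as Np.
pose proof (normal_epi_zcokernel_of_zkernel Np Kj) as Cp.
destruct (zcokernel_factor Cp Hj) as [h' ->].
apply trivial_mor_precomp, (tt_trivial HP); assumption.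
Qed.

(** If [h] trivializes the inverse image of [a] along the normal epimorphism
    [f], it trivializes the kernel of [f], so it factors through [f], and the
    factor trivializes [a]. *)
Lemma torsion_closure_normal (C : category) (Z : C -> Prop)
    (HC : semi_prenormal Z) (P : class_pair C) (c : closure_op Z) :
  is_torsion_closure_op P c -> normal_closure_op c.
Proof.
intros Hc; split; [exact (torsion_closure_idempotent Hc)|].
intros X Y f a b d Hf Hb Hd; split; [exact (cl_cont Hb Hd)|].
apply Hc; intros F h HF Hh.
destruct (zkernel_exists HC f) as (K & k & Hk).
assert (Hhk : trivial_mor Z (h ∘ k)).
{ destruct (proj2 (preimage_le k Hb)
      (normal_mono_trivial_le (nm_normal a) (proj1 Hk))) as [w ->].
  rewrite comp_assoc; apply trivial_mor_precomp; exact Hh. }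
destruct (zcokernel_factor (normal_epi_zcokernel_of_zkernel Hf Hk) Hhk)
  as [h' ->].
rewrite <- comp_assoc.
apply (proj1 (Hc X a _ (f ∘ d))); [|exact HF|].
- apply (preimage_le d Hd), sub_le_refl.
- exact (trivial_on_normal_mono HC Hf Hb Hh).
Qed.

Lemma torsion_closure_pair (C : category) (Z : C -> Prop)
    (e : forall X : C, nmono Z X) (He : forall X : C, is_coreflection Z (e X))
    (P : class_pair C) (HP : torsion_theory Z P) (c : closure_op Z) :
  is_torsion_closure_op P c -> class_pair_eq (closure_pair e c) P.
Proof.
intros Hc X; cbn; rewrite dense_iff, closed_iff, (coreflection_le _ (He X)).
assert (Te : forall F (h : hom X F), trivial_mor Z (h ∘ e X))
  by (intros F h; apply trivial_mor_dom; exact (proj1 (He X))).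
destruct (tt_exact HP X) as (T & F & t & g & HT & HF & Ht & Hg).
split; split.
- (* [g] is trivial, so the identity factors through its kernel [t]. *)
  intros H.
  assert (Hid : sub_le (idm X) t).
  { apply (zkernel_le _ Ht).
    apply (proj1 (Hc X (e X) _ (idm X)) (H X (idm X))); [exact HF | apply Te]. }
  destruct Hid as [s Es].
  apply (tt_tors_replete HP (X := T)); [|exact HT].
  exists t, s; split; [|symmetry; exact Es].
  apply (zkernel_mono Ht).
  rewrite comp_assoc, <- Es, comp_idl, comp_idr; reflexivity.
- intros HX W x; apply Hc; intros G h HG _.
  apply trivial_mor_precomp, (tt_trivial HP); assumption.
- (* [t] is trivial, so the identity factors through its cokernel [g]. *)
  intros H.
  assert (Tt : trivial_mor Z t).
  { apply (coreflection_le _ (He X)).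
    apply sub_le_trans with (n := nm_mor (cl c (e X))).
    - apply Hc; intros G h HG _; apply (tt_trivial HP); assumption.
    - apply (coreflection_le _ (He X)); exact H. }
  destruct (zcokernel_factor Hg (trivial_mor_postcomp (idm X) Tt)) as [s Es].
  apply (tt_tfree_replete HP (X := F)); [|exact HF].
  exists s, g; split; [|symmetry; exact Es].
  apply (zcokernel_epi Hg).
  rewrite <- comp_assoc, <- Es, comp_idl, comp_idr; reflexivity.
- intros HX; rewrite <- (comp_idl (cl c (e X))).
  apply (proj1 (Hc X (e X) _ _) (sub_le_refl _)); [exact HX | apply Te].
Qed.

(** The morphism [u] induced by [f] between the cokernels of [b] and [a] has
    trivial kernel: the inverse image of that kernel in [Y] is [b], which the
    cokernel of [b] kills.  So the inverse image [S] along [u] of the torsion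
    part of the cokernel of [a] is torsion. *)
Lemma torsion_closure_hereditary (C : category) (Z : C -> Prop)
    (HC : semi_prenormal Z) (P : class_pair C)
    (HP : hereditary_torsion_theory Z P) (c : closure_op Z) :
  is_torsion_closure_op P c -> hereditary c.
Proof.
destruct HP as [HP HH]; intros Hc.
split; [exact (torsion_closure_idempotent Hc)|].
intros X Y f a b d Hb Hd; split; [exact (cl_cont Hb Hd)|].
apply Hc; intros G h HG Hh.
destruct (sp_cokernels HC (nm_normal a)) as (Q & q & Hq).
destruct (sp_cokernels HC (nm_normal b)) as (R & r & Hr).
pose proof (normal_mono_zkernel_of_zcokernel (nm_normal a) Hq) as Ka.
assert (Tb : trivial_mor Z (q ∘ f ∘ b)).
{ rewrite <- comp_assoc; apply (zkernel_le _ Ka), (preimage_le b Hb).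
  apply sub_le_refl. }
destruct (zcokernel_factor Hr Tb) as [u Eu].
destruct (zkernel_exists HC u) as (N & n & Hn).
set (n' := NMono n (ex_intro _ Q (ex_intro _ u Hn)) : nmono Z R).
assert (Tn : trivial_mor Z n).
{ destruct (preimage_exists HC r n') as [p Hp].
  rewrite <- (comp_idl n).
  apply (trivial_on_normal_mono HC (zcokernel_normal_epi Hr) Hp).
  rewrite comp_idl.
  apply (zkernel_le p (normal_mono_zkernel_of_zcokernel (nm_normal b) Hr)).
  apply (preimage_le p Hb), (zkernel_le _ Ka).
  rewrite comp_assoc, Eu, <- comp_assoc; apply (zkernel_le _ Hn).
  apply (preimage_le p Hp), sub_le_refl. }
destruct (tt_exact HP Q) as (T & F & t & g & HT & HF & Ht & Hg).
assert (Nt : normal_mono Z t) by (exists F, g; exact Ht).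
destruct (sp_pullbacks HC u Nt) as (S & s & v & Hs).
assert (HS : tors P S).
{ apply (HH S T v); [|exact HT].
  destruct (zkernel_exists HC v) as (K & k & Hk).
  exists K, k; split; [exact Hk|].
  apply (normal_mono_reflects_trivial (normal_mono_pullback Nt Hs)).
  assert (Huk : trivial_mor Z (u ∘ (s ∘ k))).
  { rewrite comp_assoc, (proj1 Hs), <- comp_assoc.
    apply trivial_mor_postcomp; exact (proj1 Hk). }
  destruct (proj2 (zkernel_le _ Hn) Huk) as [w ->].
  apply trivial_mor_precomp; exact Tn. }
assert (Hrd : sub_le (r ∘ d) s).
{ apply (pullback_le _ Hs); rewrite comp_assoc, <- Eu, <- comp_assoc.
  apply (zkernel_le _ Ht); rewrite comp_assoc.
  apply (proj1 (Hc X a _ (f ∘ d))); [|exact HF|].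
  - apply (preimage_le d Hd), sub_le_refl.
  - rewrite <- comp_assoc; apply trivial_mor_postcomp; exact (proj1 Hq). }
destruct Hrd as [w Ew].
destruct (zcokernel_factor Hr Hh) as [h' ->].
rewrite <- comp_assoc, Ew, comp_assoc.
apply trivial_mor_precomp, (tt_trivial HP); assumption.
Qed.

(** * The correspondence *)

Theorem proposition6p5 (C : category) (Z : C -> Prop)
    (HZ : replete Z) (HC : semi_prenormal Z) (HR : reflective Z)
    (zeta : C -> C) (eps : forall X : C, hom (zeta X) X)
    (Heps : forall X : C, is_coreflection Z (eps X)) :
  let Phi := closure_pair (counit (sp_mono_coreflective HC) Heps) in
  induces_bijection
    (fun c : closure_op Z => weakly_hereditary c /\ normal_closure_op c)
    (@closure_op_iso C Z)
    (torsion_theory Z) (@class_pair_eq C) Phi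
  /\
  (forall c : closure_op Z, hereditary c -> weakly_hereditary c)
  /\
  induces_bijection
    (fun c : closure_op Z => hereditary c /\ normal_closure_op c)
    (@closure_op_iso C Z)
    (hereditary_torsion_theory Z) (@class_pair_eq C) Phi.
Proof.
intros Phi.
pose (e := counit (sp_mono_coreflective HC) Heps).
assert (He : forall X, is_coreflection Z (e X)) by exact Heps.
change Phi with (closure_pair e); clearbody e; clear Phi.
pose proof (hereditary_weakly_hereditary HC) as Hwh.
split; [|split; [exact Hwh|]]; (split; [|split]).
- intros c [Hw Hn]; exact (closure_torsion_theory HC He Hw Hn).
- intros c c' [Hw Hn] [Hw' Hn']; apply (closure_op_iso_iff HC He); assumption.
- intros P HP; destruct (torsion_closure_op_exists HC HP) as [c Hc].
  exists c; split; [split|].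
  + exact (torsion_closure_weakly_hereditary HC HP Hc).
  + exact (torsion_closure_normal HC Hc).
  + exact (torsion_closure_pair He HP Hc).
- intros c [Hh Hn]; exact (closure_hereditary_torsion_theory HC He Hh Hn).
- intros c c' [Hh Hn] [Hh' Hn']; apply (closure_op_iso_iff HC He); auto.
- intros P HP; destruct (torsion_closure_op_exists HC (proj1 HP)) as [c Hc].
  exists c; split; [split|].
  + exact (torsion_closure_hereditary HC HP Hc).
  + exact (torsion_closure_normal HC Hc).
  + exact (torsion_closure_pair He (proj1 HP) Hc).
Qed.
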